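(* There exist a minimal subshift $X \subseteq \{0,1\}^{\mathbb{Z}}$ and points $x_z \in X$, indexed by $z \in \{0,1\}^{\mathbb{N}}$, such that for all $z \neq z'$ in $\{0,1\}^{\mathbb{N}}$: the Turing degrees $\deg_T x_z$ and $\deg_T x_{z'}$ are incomparable, and there is no point $y \in X$ with both $\deg_T y \leq_T \deg_T x_z$ and $\deg_T y \leq_T \deg_T x_{z'}$.
   Context: A subshift of $\{0,1\}^{\mathbb{Z}}$ is a nonempty-or-empty closed (in the product topology) subset invariant under the shift $\sigma(c)_n = c_{n+1}$ and its inverse; its elements are called points. A subshift $X$ is minimal if it is nonempty and contains no nonempty subshift $Y \subsetneq X$ (equivalently, all points of $X$ contain the same finite patterns). The Turing degree of a point of $\{0,1\}^{\mathbb{Z}}$ is the Turing degree of the sequence obtained by listing its values along a fixed computable bijection $\mathbb{N} \to \mathbb{Z}$. *)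

(* Defs.v *)
From Stdlib Require Import ZArith List.
Import ListNotations.

Definition point := Z -> bool.

Definition shift (c : point) : point := fun n => c (n + 1)%Z.
Definition shift_inv (c : point) : point := fun n => c (n - 1)%Z.

Definition closed_set (X : point -> Prop) : Prop :=
  forall c : point,
    (forall N : nat, exists d, X d /\
        forall i : Z, (Z.abs i <= Z.of_nat N)%Z -> d i = c i) ->
    X c.

Definition subshift (X : point -> Prop) : Prop :=
  closed_set X /\
  (forall c, X c -> X (shift c)) /\
  (forall c, X c -> X (shift_inv c)).

Definition minimal_subshift (X : point -> Prop) : Prop :=
  subshift X /\ (exists c, X c) /\
  forall Y : point -> Prop,
    subshift Y -> (exists c, Y c) -> (forall c, Y c -> X c) ->
    forall c, X c -> Y c.

Inductive instr : Type :=
| INC (r : nat)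
| DEC (r j : nat)
| QUERY (r j : nat).

Definition program := list instr.
Definition state : Type := (nat * (nat -> nat))%type.

Definition upd (regs : nat -> nat) (r v : nat) : nat -> nat :=
  fun k => if Nat.eqb k r then v else regs k.

Definition step (O : nat -> bool) (p : program) (s : state) : option state :=
  let (pc, regs) := s in
  match nth_error p pc with
  | None => None
  | Some (INC r) => Some (S pc, upd regs r (S (regs r)))
  | Some (DEC r j) =>
      match regs r with
      | 0 => Some (j, regs)
      | S v => Some (S pc, upd regs r v)
      end
  | Some (QUERY r j) => if O (regs r) then Some (j, regs) else Some (S pc, regs)
  end.

Fixpoint run (O : nat -> bool) (p : program) (k : nat) (s : state) : state :=
  match k with
  | 0 => s
  | S k' => match step O p s with
            | None => s
            | Some s' => run O p k' s'
            end
  end.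

Definition halted (p : program) (s : state) : Prop := length p <= fst s.

Definition init_state (n : nat) : state := (0, fun k => if Nat.eqb k 0 then n else 0).

Definition computes_with (O : nat -> bool) (p : program) (A : nat -> bool) : Prop :=
  forall n : nat, exists k : nat,
    halted p (run O p k (init_state n)) /\
    snd (run O p k (init_state n)) 0 = (if A n then 1 else 0).

Definition turing_le (A B : nat -> bool) : Prop :=
  exists p : program, computes_with B p A.

(* fixed computable bijection N -> Z : 0,1,2,3,4,... |-> 0,-1,1,-2,2,... *)
Definition nat_to_Z (n : nat) : Z :=
  if Nat.even n then Z.of_nat (Nat.div2 n) else (- Z.of_nat (Nat.div2 (S n)))%Z.

Definition seq_of_point (c : point) : nat -> bool := fun n => c (nat_to_Z n).

Definition point_tle (x y : point) : Prop :=
  turing_le (seq_of_point x) (seq_of_point y).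

Definition point_incomparable (x y : point) : Prop :=
  ~ point_tle x y /\ ~ point_tle y x.

(* Main.v *)
(* X is the intersection of subshifts [Sys P_0], [Sys P_1], ..., where [Sys P] consists of the
   concatenations of two words [wa P <> wb P] of equal length, and the words of P_(n+1) are
   concatenations of those of P_n. If both new words contain all pairs of old ones, the limit is
   minimal. A condition P also prescribes, for each z, an occurrence of [wa P] around the origin
   of x_z; it depends only on finitely many digits of z and grows with n.

   Besides reflexivity, all that is used about Turing reductions is that there are countably many
   and that each is a continuous partial functional. To ensure that F(x_z) = G(x_z') is not a
   point of X, for z and z' already distinguished: either some two continuations of x_z make F
   disagree at a place, so that one of them disagrees with G there; or F has at most one total
   value y on the continuations of x_z. In that case refine the condition in two ways with
   disjoint subshifts: y lies outside one of them. Incomparability is the case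
   y = x_z. *)

From Stdlib Require Import ZArith List Lia Bool Cantor Classical ClassicalEpsilon.
From Stdlib Require Import FunctionalExtensionality.
Require Import Defs.
Import ListNotations.

(** * Oracle machines as countably many continuous partial functionals *)

Definition outputs (O : nat -> bool) (p : program) (n : nat) (v : bool) : Prop :=
  exists k, halted p (run O p k (init_state n)) /\
    snd (run O p k (init_state n)) 0 = (if v then 1 else 0).

Lemma run_halted O p k s : halted p s -> run O p k s = s.
Proof.
  destruct s as [pc regs]. unfold halted. intros H. destruct k as [|k]; auto.
  simpl. apply nth_error_None in H. simpl in H. now rewrite H.
Qed.

Lemma run_add O p j k s : run O p (j + k) s = run O p k (run O p j s).
Proof.
  revert s. induction j as [|j IH]; intros s; auto. simpl.
  destruct (step O p s) as [s'|] eqn:E; auto.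
  destruct k as [|k]; auto. simpl. now rewrite E.
Qed.

Lemma outputs_unique O p n v w : outputs O p n v -> outputs O p n w -> v = w.
Proof.
  intros [j [Hj Vj]] [k [Hk Vk]].
  assert (E : run O p j (init_state n) = run O p k (init_state n)).
  { rewrite <- (run_halted O p k _ Hj), <- (run_halted O p j _ Hk), <- !run_add.
    now rewrite Nat.add_comm. }
  rewrite E, Vk in Vj. destruct v, w; congruence.
Qed.

(** One step reads at most one oracle value. *)
Lemma run_use O p k s : exists N, forall O',
  (forall m, m < N -> O' m = O m) -> run O' p k s = run O p k s.
Proof.
  revert s. induction k as [|k IH]; intros s.
  - now exists 0.
  - destruct s as [pc regs].
    assert (exists N, forall O', (forall m, m < N -> O' m = O m) ->
      step O' p (pc, regs) = step O p (pc, regs)) as [N1 H1].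
    { simpl. destruct (nth_error p pc) as [[r|r j|r j]|].
      1, 2, 4: now exists 0.
      exists (S (regs r)). intros O' H. rewrite H; auto. }
    destruct (step O p (pc, regs)) as [s'|] eqn:E.
    + destruct (IH s') as [N2 H2]. exists (max N1 N2). intros O' H.
      cbn [run]. rewrite H1 by (intros; apply H; lia). rewrite E.
      apply H2. intros; apply H; lia.
    + exists N1. intros O' H. cbn [run]. rewrite (H1 _ H), E. reflexivity.
Qed.

Lemma outputs_use O p n v : outputs O p n v -> exists N, forall O',
  (forall m, m < N -> O' m = O m) -> outputs O' p n v.
Proof.
  intros [k [Hk Vk]]. destruct (run_use O p k (init_state n)) as [N HN].
  exists N. intros O' H. exists k. now rewrite (HN O' H).
Qed.

Definition instr_code (i : instr) : nat :=
  match i with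
  | INC r => to_nat (0, to_nat (r, 0))
  | DEC r j => to_nat (1, to_nat (r, j))
  | QUERY r j => to_nat (2, to_nat (r, j))
  end.

Fixpoint program_code (p : program) : nat :=
  match p with
  | [] => 0
  | i :: p' => S (to_nat (instr_code i, program_code p'))
  end.

Lemma instr_code_inj i i' : instr_code i = instr_code i' -> i = i'.
Proof.
  destruct i, i'; unfold instr_code; intros E; apply to_nat_inj in E;
    pose proof (f_equal fst E) as E1; apply (f_equal snd) in E; cbn [fst snd] in *;
    try discriminate; apply to_nat_inj in E; congruence.
Qed.

Lemma program_code_inj p p' : program_code p = program_code p' -> p = p'.
Proof.
  revert p'. induction p as [|i p IH]; intros [|i' p'] E; cbn [program_code] in E; try easy.
  apply eq_add_S, to_nat_inj in E.
  pose proof (f_equal fst E) as E1. apply (f_equal snd) in E. cbn [fst snd] in *.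
  now rewrite (instr_code_inj _ _ E1), (IH _ E).
Qed.

Definition agree (N : nat) (x y : point) : Prop :=
  forall i : Z, (Z.abs i <= Z.of_nat N)%Z -> x i = y i.

Definition functional (F : point -> nat -> bool -> Prop) : Prop :=
  (forall x n v w, F x n v -> F x n w -> v = w) /\
  (forall x n v, F x n v -> exists N, forall x', agree N x' x -> F x' n v).

(** Numerical indices let stage [n] treat only those below [n]. A number coding no program gives the
    nowhere defined functional. *)
Definition evals (e : nat) (x : point) (n : nat) (v : bool) : Prop :=
  exists p, program_code p = e /\ outputs (seq_of_point x) p n v.

Lemma nat_to_Z_bound n : (Z.abs (nat_to_Z n) <= Z.of_nat n)%Z.
Proof.
  unfold nat_to_Z. pose proof (Nat.le_div2_diag_l n). pose proof (Nat.le_div2 n).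
  destruct (Nat.even n); [|rewrite Z.abs_opp]; rewrite Z.abs_eq by apply Nat2Z.is_nonneg;
    now apply inj_le.
Qed.

Lemma nat_to_Z_surj i : exists n, nat_to_Z n = i.
Proof.
  unfold nat_to_Z. destruct (Z.leb_spec 0 i).
  - exists (2 * Z.to_nat i). rewrite Nat.even_even, Nat.div2_double. lia.
  - exists (2 * Z.to_nat (- i - 1) + 1).
    rewrite Nat.even_odd.
    replace (S (2 * Z.to_nat (- i - 1) + 1)) with (2 * Z.to_nat (- i)) by lia.
    rewrite Nat.div2_double. lia.
Qed.

Lemma seq_of_point_inj x y :
  (forall n, seq_of_point x n = seq_of_point y n) -> forall i, x i = y i.
Proof. intros H i. destruct (nat_to_Z_surj i) as [n <-]. apply H. Qed.

Lemma functional_evals e : functional (evals e).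
Proof.
  split.
  - intros x n v w [p [<- Hv]] [q [E Hw]]. apply program_code_inj in E. subst q.
    eapply outputs_unique; eauto.
  - intros x n v [p [E H]]. destruct (outputs_use _ _ _ _ H) as [N HN].
    exists N. intros x' A. exists p. split; auto. apply HN.
    intros m Hm. apply A. pose proof (nat_to_Z_bound m). lia.
Qed.

(* The program tests the oracle at its input, then clears register 0 in a loop; register 1 is
   constantly 0, so that [DEC 1 j] is an unconditional jump to [j]. *)
Definition copy_oracle : program :=
  [QUERY 0 4; DEC 0 3; DEC 1 1; DEC 1 7; DEC 0 6; DEC 1 4; INC 0].

(** The loop occurs twice, at 1 and at 4, so that the program counter remembers the oracle's answer
    while register 0 is cleared. *)
Lemma copy_oracle_clear O v pc regs : pc = 1 \/ pc = 4 -> regs 0 = v -> regs 1 = 0 ->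
  exists k regs', run O copy_oracle k (pc, regs) = (pc + 2, regs') /\
    regs' 0 = 0 /\ regs' 1 = 0.
Proof.
  intros Hpc. revert regs. induction v as [|v IH]; intros regs H0 H1.
  - exists 1, regs. destruct Hpc; subst pc; simpl; rewrite H0; auto.
  - destruct (IH (upd regs 0 v)) as [k [regs' [E H]]]; auto.
    exists (2 + k), regs'. split; auto. rewrite run_add, <- E. f_equal.
    destruct Hpc; subst pc; simpl; rewrite H0; simpl; unfold upd at 1; simpl;
      rewrite H1; reflexivity.
Qed.

Lemma turing_le_refl A : turing_le A A.
Proof.
  exists copy_oracle. intros n.
  assert (S1 : run A copy_oracle 1 (init_state n) =
    (if A n then 4 else 1, snd (init_state n))).
  { simpl. destruct (A n); reflexivity. }
  destruct (copy_oracle_clear A n (if A n then 4 else 1) (snd (init_state n)))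
    as [k [regs [E [R0 R1]]]]; [destruct (A n); auto | reflexivity | reflexivity |].
  exists (1 + (k + 1)). rewrite run_add, S1, run_add, E. unfold halted.
  destruct (A n); simpl; rewrite ?R1; simpl; unfold upd; simpl; rewrite ?R0; auto.
Qed.

(** * Constant-length substitutions and the conditions *)

Open Scope Z_scope.

Definition subst (L : Z) (a b : Z -> bool) (c : point) : point :=
  fun i => (if c (i / L) then a else b) (i mod L).

Lemma subst_add L a b c i q : 0 < L ->
  subst L a b c (i + q * L) = (if c (i / L + q) then a else b) (i mod L).
Proof. intros H. unfold subst. now rewrite Z.div_add, Z_mod_plus_full by lia. Qed.

Lemma subst_block L a b c j r : 0 <= r < L ->
  subst L a b c (r + j * L) = (if c j then a else b) r.
Proof.
  intros H. rewrite subst_add by lia. now rewrite Z.div_small, Z.mod_small by lia.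
Qed.

Lemma subst_subst L M a b u v c i : 0 < L -> 0 < M ->
  subst (M * L) (subst L a b u) (subst L a b v) c i = subst L a b (subst M u v c) i.
Proof.
  intros HL HM. unfold subst at 1 4 5.
  rewrite (Z.mul_comm M L), <- Z.div_div, Z.rem_mul_r, (Z.mul_comm L (_ mod M)) by lia.
  destruct (c (i / L / M)); apply subst_block, Z.mod_pos_bound; lia.
Qed.

(* Only the values of the words [wa] and [wb] on [0, len) matter. *)
Record cond : Type := Cond {
  len : Z; wa : Z -> bool; wb : Z -> bool; off : (nat -> bool) -> Z;
  len_pos : 0 < len;
  words_differ : exists d, 0 <= d < len /\ wa d <> wb d;
  off_range : forall z, 0 <= off z < len }.

Definition expand (P : cond) : point -> point := subst (len P) (wa P) (wb P).

Definition Sys (P : cond) (x : point) : Prop :=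
  exists c k, forall i, x i = expand P c (i + k).

Definition Cyl (P : cond) (z : nat -> bool) (x : point) : Prop :=
  exists c, c 0 = true /\ forall i, x i = expand P c (i + off P z).

Definition closure (A : point -> Prop) (x : point) : Prop :=
  forall N, exists d, A d /\ agree N d x.

Definition same (n : nat) (z z' : nat -> bool) : Prop :=
  forall m, (m < n)%nat -> z m = z' m.

Lemma same_sym n z z' : same n z z' -> same n z' z.
Proof. intros H m Hm. symmetry. auto. Qed.

Lemma same_trans n z z' z'' : same n z z' -> same n z' z'' -> same n z z''.
Proof. intros H H' m Hm. rewrite H; auto. Qed.

Definition uniform (n : nat) (P : cond) : Prop :=
  forall z z', same n z z' -> off P z = off P z'.

(** The last clause keeps uniformity at [n] through the several extensions made within one stage. *)
Definition extends (n : nat) (Q P : cond) : Prop :=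
  (forall x, Sys Q x -> Sys P x) /\
  (forall z x, Cyl Q z x -> Cyl P z x) /\
  len P <= len Q /\
  (uniform n P -> uniform n Q).

Lemma extends_refl n P : extends n P P.
Proof. repeat split; auto. lia. Qed.

Lemma extends_trans n P Q R : extends n R Q -> extends n Q P -> extends n R P.
Proof.
  intros [A1 [A2 [A3 A4]]] [B1 [B2 [B3 B4]]]. repeat split; auto. lia.
Qed.

Lemma closure_mono (A B : point -> Prop) :
  (forall x, A x -> B x) -> forall x, closure A x -> closure B x.
Proof. intros H x Hx N. destruct (Hx N) as [d [Hd Ad]]. eauto. Qed.

(** Every proper refinement below arises this way: [u] and [v] spell the new words in the old ones,
    and the old block at the origin of x_z becomes number [p z] of [u], hence the requirement
    [u (p z) = true]. *)
Lemma refine_by n P M (u v : Z -> bool) (p : (nat -> bool) -> Z) :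
  (exists j, 0 <= j < M /\ u j <> v j) ->
  (forall z, 0 <= p z < M /\ u (p z) = true) ->
  (forall z z', same n z z' -> p z = p z') ->
  exists Q, extends n Q P /\ len Q = M * len P /\
    (forall z, off Q z = off P z + p z * len P) /\
    (forall c i, expand Q c i = expand P (subst M u v c) i).
Proof.
  intros [j [Hj Huv]] Hp Hsame.
  destruct P as [L a b k HL [d [Hd Hab]] Hk].
  assert (HM : 0 < M) by lia.
  assert (L' : 0 < M * L) by lia.
  assert (W' : exists d, 0 <= d < M * L /\ subst L a b u d <> subst L a b v d).
  { exists (d + j * L). split; [nia|]. rewrite !subst_block by lia.
    destruct (u j), (v j); congruence. }
  assert (O' : forall z, 0 <= k z + p z * L < M * L).
  { intros z. specialize (Hk z). destruct (Hp z). nia. }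
  pose (Q := Cond _ _ _ _ L' W' O').
  assert (HE : forall c i, expand Q c i =
    expand (Cond L a b k HL (ex_intro _ d (conj Hd Hab)) Hk) (subst M u v c) i).
  { intros c i. now apply subst_subst. }
  exists Q. split; [|auto]. split; [|split; [|split]].
  + intros x [c [k' Hx]]. exists (subst M u v c), k'. intros i. now rewrite Hx, HE.
  + intros z x [c [Hc Hx]]. destruct (Hp z) as [Hpz Hu].
    exists (fun i => subst M u v c (i + p z)). split.
    * unfold subst. simpl. now rewrite Z.div_small, Z.mod_small, Hc by lia.
    * intros i. rewrite Hx, HE. unfold Q, expand; simpl.
      rewrite Z.add_assoc, subst_add by lia. reflexivity.
  + simpl. nia.
  + intros HU z z' Hz. specialize (HU z z' Hz). simpl in *. now rewrite HU, (Hsame z z').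
Qed.

(** One word [u] holds the letters around both origins. The first [n] digits of [z] decide which of
    the two places [p z] is, so the two points can be continued independently. *)
Lemma extend_windows n P z0 z1 x0 x1 N : ~ same n z1 z0 ->
  Cyl P z0 x0 -> Cyl P z1 x1 ->
  exists Q, extends n Q P /\
    (forall x, Cyl Q z0 x -> agree N x x0) /\ (forall x, Cyl Q z1 x -> agree N x x1).
Proof.
  intros Hz [c0 [H0 E0]] [c1 [H1 E1]].
  (* A window of radius [N] meets only blocks with numbers in [-K, K]. So [u] consists of two
     stretches of [2 * K + 1] letters, centred at [K] and [3 * K + 1]. *)
  pose (K := Z.of_nat N + len P).
  pose (u := fun j => if j <=? 2 * K then c0 (j - K) else c1 (j - (3 * K + 1))).
  pose (p := fun z => if excluded_middle_informative (same n z z0) then K else 3 * K + 1).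
  pose proof (len_pos P) as HL.
  assert (HK : 0 < K) by lia.
  assert (U0 : forall j, - K <= j <= K -> u (j + K) = c0 j).
  { intros j Hj. unfold u. destruct (Z.leb_spec (j + K) (2 * K)); [f_equal|]; lia. }
  assert (U1 : forall j, - K <= j <= K -> u (j + (3 * K + 1)) = c1 j).
  { intros j Hj. unfold u. destruct (Z.leb_spec (j + (3 * K + 1)) (2 * K)); [|f_equal]; lia. }
  assert (p0 : p z0 = K).
  { unfold p. destruct excluded_middle_informative as [|A]; auto. now destruct A. }
  assert (p1 : p z1 = 3 * K + 1).
  { unfold p. destruct excluded_middle_informative; tauto. }
  destruct (refine_by n P (4 * K + 2) u (fun j => negb (u j)) p) as [Q [HQ [_ [HO HE]]]].
  - exists 0. split; [lia|]. now destruct (u 0).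
  - intros z. unfold p. destruct excluded_middle_informative.
    + split; [lia|]. rewrite <- H0, <- (U0 0) by lia. reflexivity.
    + split; [lia|]. rewrite <- H1, <- (U1 0) by lia. reflexivity.
  - intros z z' Hs. unfold p. do 2 destruct excluded_middle_informative as [|];
      auto; exfalso; eauto using same_trans, same_sym.
  - assert (W : forall z x i, Cyl Q z x -> Z.abs i <= Z.of_nat N ->
      -K <= (i + off P z) / len P <= K /\
      x i = (if u ((i + off P z) / len P + p z) then wa P else wb P)
              ((i + off P z) mod len P)).
    { intros z x i [c [Hc Hx]] Hi. pose proof (off_range P z) as Hoff.
      assert (B : -K <= (i + off P z) / len P <= K).
      { split; [apply Z.div_le_lower_bound|apply Z.div_le_upper_bound]; nia. }
      split; auto. rewrite Hx, HE, HO, Z.add_assoc. unfold expand.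
      rewrite subst_add by lia. unfold subst at 1.
      assert (0 <= (i + off P z) / len P + p z < 4 * K + 2).
      { unfold p. destruct excluded_middle_informative; lia. }
      now rewrite Z.div_small, Z.mod_small, Hc by lia. }
    exists Q. split; auto. split; intros x Hx i Hi; destruct (W _ _ i Hx Hi) as [B ->].
    + rewrite p0, U0, E0 by auto. reflexivity.
    + rewrite p1, U1, E1 by auto. reflexivity.
Qed.

(* Points of [Q1] have no long [len P]-periodic stretch, since in them no letter is repeated
   three times; points of [Q2] have such stretches. *)
Lemma separate n P : exists Q1 Q2, extends n Q1 P /\ extends n Q2 P /\
  forall y, closure (Sys Q1) y -> closure (Sys Q2) y -> False.
Proof.
  (* With a, b for the words of [P], the words of [Q1] are ab and ba, those of [Q2] are aaaa and
     bbbb. *)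
  destruct (refine_by n P 2 (fun j => j =? 0) (fun j => negb (j =? 0)) (fun _ => 0))
    as [Q1 [X1 [_ [_ E1]]]]; [exists 0; split; [lia|discriminate] | split; [lia|auto] | auto |].
  destruct (refine_by n P 4 (fun _ => true) (fun _ => false) (fun _ => 0))
    as [Q2 [X2 [_ [_ E2]]]]; [exists 0; split; [lia|discriminate] | split; [lia|auto] | auto |].
  exists Q1, Q2. split; [auto|]. split; [auto|].
  intros y H1 H2.
  pose proof (len_pos P) as HL. destruct (words_differ P) as [d [Hd Hab]].
  set (L := len P) in *.
  destruct (H1 (Z.to_nat (12 * L))) as [y1 [[c1 [k1 S1]] A1]].
  destruct (H2 (Z.to_nat (12 * L))) as [y2 [[c2 [k2 S2]] A2]].
  (* [j] starts a block of four equal letters in [y2]; a shift by [L] from any of the first three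
     stays in it. *)
  assert (exists j, 0 <= j < 4 * L /\ forall i, j <= i < j + 3 * L -> y2 i = y2 (i + L))
    as [j [Hj Per]].
  { pose proof (Z.div_mod (- k2) (4 * L) ltac:(lia)) as E.
    pose proof (Z.mod_pos_bound (- k2) (4 * L) ltac:(lia)).
    set (j := (- k2) mod (4 * L)) in *. set (q := (- k2) / (4 * L)) in *.
    exists j. split; [lia|]. intros i Hi. rewrite !S2, !E2. unfold expand. fold L.
    replace (i + L + k2) with (i - j + (1 - q * 4) * L) by lia.
    replace (i + k2) with (i - j + (0 - q * 4) * L) by lia.
    rewrite !subst_add by lia.
    assert (B : 0 <= (i - j) / L < 3).
    { split; [apply Z.div_le_lower_bound|apply Z.div_lt_upper_bound]; lia. }
    unfold subst.
    replace (((i - j) / L + (0 - q * 4)) / 4) with (- q) by (Z.div_mod_to_equations; lia).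
    replace (((i - j) / L + (1 - q * 4)) / 4) with (- q) by (Z.div_mod_to_equations; lia).
    now destruct (c2 (- q)). }
  assert (exists i, j <= i < j + 3 * L /\ y1 i <> y1 (i + L)) as [i [Hi NP]].
  (* Letter [m] is the first to start after [j], and [m'] is the next one opening a pair ab or ba.
     Place [d] of letter [m'] is less than [3 * L] beyond [j]. *)
  { pose (m := (j + k1) / L + 1).
    pose proof (Z.div_mod (j + k1) L ltac:(lia)).
    pose proof (Z.mod_pos_bound (j + k1) L ltac:(lia)).
    assert (exists m', m <= m' <= m + 1 /\
      subst 2 (fun j => j =? 0) (fun j => negb (j =? 0)) c1 m' <>
      subst 2 (fun j => j =? 0) (fun j => negb (j =? 0)) c1 (m' + 1)) as [m' [Hm' D]].
    { unfold subst. pose (m' := if m mod 2 =? 0 then m else m + 1).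
      exists m'. assert (m <= m' <= m + 1 /\ m' mod 2 = 0 /\ (m' + 1) mod 2 = 1
        /\ (m' + 1) / 2 = m' / 2) as [? [-> [-> ->]]].
      { unfold m'. destruct (Z.eqb_spec (m mod 2) 0); Z.div_mod_to_equations; lia. }
      split; [auto|]. now destruct (c1 (m' / 2)). }
    exists (d + m' * L - k1). split; [unfold m in *; nia|].
    rewrite !S1, !E1. unfold expand. fold L.
    replace (d + m' * L - k1 + k1) with (d + m' * L) by ring.
    replace (d + m' * L - k1 + L + k1) with (d + (m' + 1) * L) by ring.
    rewrite !subst_block by lia.
    destruct (subst 2 _ _ c1 m'), (subst 2 _ _ c1 (m' + 1)); congruence. }
  apply NP. rewrite !A1, <- !A2 by lia. apply Per. lia.
Qed.

(** Makes the points x_z converge: further extensions no longer change them on this window. *)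
Definition narrow (N : nat) (P : cond) : Prop :=
  forall z x x', Cyl P z x -> Cyl P z x' -> agree N x x'.

(** Uniform recurrence. As [R] is common to all points, it survives approximation on finite
    windows. *)
Definition syndetic (N : nat) (P : cond) : Prop :=
  exists R, forall x y, Sys P x -> Sys P y ->
    exists j, 0 <= j < R /\ forall i, Z.abs i <= Z.of_nat N -> x (i + j) = y i.

(** A window of radius [N] meets at most two consecutive blocks, so [syndetic] follows once both new
    words contain all pairs of letters. For [narrow], the origin is put in letter 2 of [u], whose
    neighbours on both sides keep the window inside [wa Q]. *)
Lemma grow n N P : 2 * Z.of_nat N <= len P ->
  exists Q, extends n Q P /\ 6 * len P <= len Q /\ narrow N Q /\ syndetic N Q.
Proof.
  intros HN. pose proof (len_pos P) as HL.
  (* Both words start with 00110, which has all four two-letter words as factors. *)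
  pose (u := fun j => (2 <=? j) && negb (j =? 4)).
  pose (v := fun j => (2 <=? j) && (j <=? 3)).
  destruct (refine_by n P 6 u v (fun _ => 2)) as [Q [HQ [HLQ [HO HE]]]];
    [exists 5; split; [lia|discriminate] | split; [lia|auto] | auto |].
  exists Q. split; [auto|]. split; [lia|]. split.
  - intros z x x' [c [Hc Hx]] [c' [Hc' Hx']] i Hi.
    rewrite Hx, Hx'. unfold expand, subst. rewrite HLQ, HO.
    pose proof (off_range P z).
    now rewrite Z.div_small, Hc, Hc' by lia.
  - exists (6 * len P). intros x y [c' [k' Hx]] [c [k Hy]].
    pose (e := subst 6 u v c). pose (e' := subst 6 u v c').
    set (L := len P) in *.
    pose (m := (k - Z.of_nat N) / L).
    (* One [t] serves all [q], as both words begin with the same five letters; hence [J] can be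
       reduced modulo [6 * L]. *)
    assert (exists t, forall q, e' (6 * q + t) = e m /\ e' (6 * q + t + 1) = e (m + 1))
      as [t Ht].
    { assert (T : forall q s, 0 <= s <= 4 -> e' (6 * q + s) = u s).
      { intros q s Hs. unfold e'. replace (6 * q + s) with (s + q * 6) by ring.
        rewrite subst_block by lia.
        assert (U : s = 0 \/ s = 1 \/ s = 2 \/ s = 3 \/ s = 4) by lia.
        destruct (c' q); [auto|]. now destruct U as [->|[->|[->|[->| ->]]]]. }
      assert (T' : forall b b', exists t, 0 <= t <= 3 /\ u t = b /\ u (t + 1) = b').
      { intros [] []; [exists 2 | exists 3 | exists 1 | exists 0]; split; (lia || auto). }
      destruct (T' (e m) (e (m + 1))) as [t [Ht [<- <-]]]. exists t. intros q.
      rewrite <- Z.add_assoc, !T by lia. auto. }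
    pose (J := k - k' + (t - m) * L).
    pose proof (Z.div_mod J (6 * L) ltac:(lia)).
    exists (J mod (6 * L)). split; [apply Z.mod_pos_bound; lia|]. intros i Hi.
    rewrite Hx, Hy, !HE. unfold expand. fold L e e'.
    pose (q := - (J / (6 * L))).
    replace (i + J mod (6 * L) + k') with ((i + k) + (6 * q + t - m) * L)
      by (unfold q, J in *; nia).
    rewrite subst_add by lia. unfold subst.
    assert (B : m <= (i + k) / L <= m + 1).
    { unfold m. pose proof (Z.div_mod (k - Z.of_nat N) L ltac:(lia)).
      pose proof (Z.mod_pos_bound (k - Z.of_nat N) L ltac:(lia)).
      split; [apply Z.div_le_lower_bound|apply Z.lt_succ_r, Z.div_lt_upper_bound]; nia. }
    destruct (Ht q) as [T0 T1].
    assert (C : (i + k) / L = m \/ (i + k) / L = m + 1) by lia.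
    destruct C as [->| ->].
    + replace (m + (6 * q + t - m)) with (6 * q + t) by ring. now rewrite T0.
    + replace (m + 1 + (6 * q + t - m)) with (6 * q + t + 1) by ring. now rewrite T1.
Qed.

(** * Forcing a single requirement *)

Definition avoids (F G : point -> nat -> bool -> Prop) (z z' : nat -> bool) (P : cond) : Prop :=
  forall x x' y, Cyl P z x -> Cyl P z' x' -> closure (Sys P) y ->
    (forall i, F x i (seq_of_point y i)) -> (forall i, G x' i (seq_of_point y i)) -> False.

Lemma avoids_extends F G z z' n P Q :
  extends n Q P -> avoids F G z z' P -> avoids F G z z' Q.
Proof.
  intros [A [B _]] H x x' y Hx Hx' Hy. apply H; auto. eapply closure_mono; eauto.
Qed.

(* If [F] takes two values at some place, one of them disagrees with [G] there. Otherwise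
   [F] has at most one total value, which one of two disjoint systems does not contain. *)
Lemma force_avoids n F G z z' P : functional F -> functional G -> ~ same n z' z ->
  exists Q, extends n Q P /\ avoids F G z z' Q.
Proof.
  intros [DF CF] [DG CG] Hz.
  destruct (classic (exists x0 x1 i, Cyl P z x0 /\ Cyl P z x1 /\ F x0 i false /\ F x1 i true))
    as [[x0 [x1 [i [H0 [H1 [V0 V1]]]]]]|Const].
  (* If [G] has no value at [i] on the cylinder of [z'], then [P] itself serves. Otherwise both
     computations are fixed on a window, with different values. *)
  - destruct (classic (exists x' v, Cyl P z' x' /\ G x' i v)) as [[x' [v [H' V']]]|Undef].
    + assert (exists x, Cyl P z x /\ F x i (negb v)) as [x [H V]].
      { destruct v; [exists x0 | exists x1]; auto. }
      destruct (CF _ _ _ V) as [N HN]. destruct (CG _ _ _ V') as [N' HN'].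
      destruct (extend_windows n P z z' x x' (max N N') Hz H H') as [Q [HQ [A A']]].
      exists Q. split; auto. intros w w' y Hw Hw' _ Fy Gy.
      assert (E : negb v = seq_of_point y i).
      { apply (DF w i); auto. apply HN. intros k Hk. apply A; auto. lia. }
      assert (E' : v = seq_of_point y i).
      { apply (DG w' i); auto. apply HN'. intros k Hk. apply A'; auto. lia. }
      rewrite <- E' in E. now destruct v.
    + exists P. split; [apply extends_refl|]. intros w w' y _ Hw' _ _ Gy.
      apply Undef. exists w', (seq_of_point y i). auto.
  - destruct (separate n P) as [Q1 [Q2 [X1 [X2 D]]]].
    apply NNPP. intros No.
    (* If neither [Q1] nor [Q2] serves, each closure contains a total value of [F] on the cylinder
       of [P]; by [Const] the two coincide. *)
    assert (W : forall Q, extends n Q P -> exists x y, Cyl P z x /\ closure (Sys Q) y /\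
      forall i, F x i (seq_of_point y i)).
    { intros Q HQ. apply NNPP. intros A. apply No. exists Q. split; auto.
      intros x x' y Hx _ Hy Fy _. apply A. exists x, y. split; auto.
      now apply HQ. }
    destruct (W Q1 X1) as [x1 [y1 [H1 [S1 F1]]]].
    destruct (W Q2 X2) as [x2 [y2 [H2 [S2 F2]]]].
    apply (D y1); auto. replace y1 with y2; auto.
    apply functional_extensionality, seq_of_point_inj. intros i.
    specialize (F1 i). specialize (F2 i).
    destruct (seq_of_point y1 i) eqn:V1, (seq_of_point y2 i) eqn:V2; auto;
      exfalso; apply Const; eauto 8.
Qed.

(** * Meeting finitely many requirements in each stage *)

Lemma force_list {A} (T : A -> cond -> Prop) n :
  (forall a P, exists Q, extends n Q P /\ T a Q) ->
  (forall a P Q, extends n Q P -> T a P -> T a Q) ->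
  forall (l : list A) P, exists Q, extends n Q P /\ forall a, In a l -> T a Q.
Proof.
  intros D M. induction l as [|a l IH]; intros P.
  - exists P. split; [apply extends_refl|easy].
  - destruct (IH P) as [Q [HQ TQ]]. destruct (D a Q) as [R [HR TR]].
    exists R. split; [eapply extends_trans; eauto|].
    intros b [<-|Hb]; eauto.
Qed.

(** Leaves only finitely many pairs [z], [z'] to treat at stage [n]. *)
Lemma same_representatives n :
  exists l : list (nat -> bool), forall z, exists r, In r l /\ same n z r.
Proof.
  induction n as [|n [l Hl]].
  - exists [fun _ => true]. intros z. eexists. split; [now left|]. intros m Hm. lia.
  - exists (flat_map (fun r => [(fun m => if Nat.eqb m n then true else r m);
                             (fun m => if Nat.eqb m n then false else r m)]) l).
    intros z. destruct (Hl z) as [r [Hr Sr]].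
    exists (fun m => if Nat.eqb m n then z n else r m). split.
    + apply in_flat_map. exists r. split; auto. destruct (z n); simpl; auto.
    + intros m Hm. destruct (Nat.eqb_spec m n); [now subst|]. apply Sr. lia.
Qed.

Definition stage_ok (n : nat) (P : cond) : Prop := uniform n P /\ 2 * Z.of_nat n <= len P.

Definition stage_step (n : nat) (P Q : cond) : Prop :=
  stage_ok (S n) Q /\ extends n Q P /\ narrow n Q /\ syndetic n Q /\
  forall z z' e e', ~ same n z' z -> (e < n)%nat -> (e' < n)%nat ->
    avoids (evals e) (evals e') z z' Q.

Lemma uniform_Cyl n P z z' x : uniform n P -> same n z z' -> Cyl P z x -> Cyl P z' x.
Proof. intros U S [c H]. exists c. now rewrite <- (U z z' S). Qed.

(** The requirements are met for representatives, then [grow] is applied; uniformity of the result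
    carries them over to all [z] and [z']. *)
Lemma stage n P : stage_ok n P -> exists Q, stage_step n P Q.
Proof.
  intros [U HL]. destruct (same_representatives n) as [l Hl].
  pose (T := fun (a : (nat -> bool) * (nat -> bool) * (nat * nat)) Q =>
    let '(z, z', (e, e')) := a in
    ~ same n z' z -> avoids (evals e) (evals e') z z' Q).
  destruct (force_list T n) with
    (l := list_prod (list_prod l l) (list_prod (seq 0 n) (seq 0 n))) (P := P)
    as [Q [HQ TQ]].
  - intros [[z z'] [e e']] R. destruct (classic (same n z' z)) as [S|S].
    + exists R. split; [apply extends_refl|easy].
    + destruct (force_avoids n (evals e) (evals e') z z' R) as [Q [HQ A]];
        auto using functional_evals.
      exists Q. split; auto. now intros _.
  - intros [[z z'] [e e']] R Q HQ H S. eapply avoids_extends; eauto.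
  - destruct (grow n n Q) as [R [HR [LR [NR SR]]]].
    { destruct HQ as [_ [_ [? _]]]. lia. }
    pose proof (extends_trans _ _ _ _ HR HQ) as HRP.
    assert (UR : uniform n R) by (now apply HRP).
    exists R. split; [|split; [auto|split; [auto|split; [auto|]]]].
    + split.
      * intros z z' S. apply UR. intros m Hm. apply S. lia.
      * destruct HQ as [_ [_ [? _]]]. pose proof (len_pos P). lia.
    + intros z z' e e' S He He'.
      destruct (Hl z) as [r [Hr Sr]]. destruct (Hl z') as [r' [Hr' Sr']].
      assert (A : avoids (evals e) (evals e') r r' R).
      { apply (avoids_extends _ _ _ _ n Q R HR). apply (TQ (r, r', (e, e'))).
        - rewrite !in_prod_iff, !in_seq. repeat split; auto; lia.
        - intros S'. eauto using same_trans, same_sym. }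
      intros x x' y Hx Hx'. apply A; eapply uniform_Cyl; eauto.
Qed.

(** * The limit subshift and its points *)

Lemma Cyl_closed P z x : closure (Cyl P z) x -> Cyl P z x.
Proof.
  intros H. pose proof (len_pos P) as HL. destruct (words_differ P) as [d [Hd Hab]].
  (* The letters are decoded from [x] at place [d] of each block, where the two words differ, so
     each depends on a single value of [x]. *)
  pose (c := fun j => Bool.eqb (x (d + j * len P - off P z)) (wa P d)).
  assert (W : forall i j, exists c', c' 0 = true /\ c j = c' j /\
    x i = expand P c' (i + off P z)).
  { intros i j.
    destruct (H (Z.to_nat (Z.abs i + Z.abs (d + j * len P - off P z)))) as [y [[c' [H0 Hc']] A]].
    exists c'. split; [auto|]. split.
    - unfold c. rewrite <- A, Hc' by lia.
      replace (d + j * len P - off P z + off P z) with (d + j * len P) by ring.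
      unfold expand. rewrite subst_block by auto.
      destruct (c' j), (wa P d), (wb P d); simpl; congruence.
    - rewrite <- A by lia. apply Hc'. }
  exists c. split.
  - destruct (W 0 0) as [c' [H0 [-> _]]]. auto.
  - intros i. destruct (W i ((i + off P z) / len P)) as [c' [_ [E ->]]].
    unfold expand, subst. now rewrite E.
Qed.

Lemma Cyl_Sys P z x : Cyl P z x -> Sys P x.
Proof. intros [c [_ H]]. exists c, (off P z). auto. Qed.

Lemma subshift_ext X c d : subshift X -> X c -> (forall i, c i = d i) -> X d.
Proof. intros [HX _] Hc E. apply HX. intros N. exists c. auto. Qed.

Lemma subshift_translate X c k : subshift X -> X c -> X (fun i => c (i + k)).
Proof.
  intros HX Hc. pose proof HX as [_ [HS HS']].
  assert (N : forall n : nat, X (fun i => c (i + Z.of_nat n)) /\ X (fun i => c (i - Z.of_nat n))).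
  { induction n as [|n [IH IH']].
    - split; apply (subshift_ext X c _ HX Hc); intros i; f_equal; lia.
    - split; [refine (subshift_ext X _ _ HX (HS _ IH) _) |
              refine (subshift_ext X _ _ HX (HS' _ IH') _)];
        intros i; unfold shift, shift_inv; f_equal; lia. }
  destruct (Z.leb_spec 0 k).
  - refine (subshift_ext X _ _ HX (proj1 (N (Z.to_nat k))) _). intros i. f_equal. lia.
  - refine (subshift_ext X _ _ HX (proj2 (N (Z.to_nat (- k)))) _). intros i. f_equal. lia.
Qed.

Lemma Sys_translate P k x : Sys P x -> Sys P (fun i => x (i + k)).
Proof.
  intros [c [k' H]]. exists c, (k + k'). intros i. rewrite H. f_equal. ring.
Qed.

Definition limit (P : nat -> cond) (x : point) : Prop := forall n, closure (Sys (P n)) x.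

Lemma limit_subshift P : subshift (limit P).
Proof.
  assert (T : forall k c, Z.abs k <= 1 -> limit P c -> limit P (fun i => c (i + k))).
  { intros k c Hk Hc n N. destruct (Hc n (S N)) as [d [Hd A]].
    exists (fun i => d (i + k)). split; [now apply Sys_translate|].
    intros i Hi. apply A. lia. }
  split; [|split].
  - intros c H n N. destruct (H N) as [d [Hd A]]. destruct (Hd n N) as [d' [Hd' A']].
    exists d'. split; auto. intros i Hi. now rewrite A', A.
  - intros c. apply (T 1). lia.
  - intros c. apply (T (-1)). lia.
Qed.

(** A window of [x] recurs in [y] within distance [R], so it is enough to approximate [y] on radius
    [N + R] by a point of [Sys (P n)]. *)
Lemma limit_minimal P : (forall N, exists n, syndetic N (P n)) ->
  forall Y : point -> Prop, subshift Y -> (exists c, Y c) -> (forall c, Y c -> limit P c) ->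
  forall c, limit P c -> Y c.
Proof.
  intros HS Y HY [y Hy] YX x Hx. apply (proj1 HY). intros N.
  destruct (HS N) as [n [R HR]].
  destruct (YX y Hy n (Z.to_nat (Z.of_nat N + R))) as [y' [Sy Ay]].
  destruct (Hx n N) as [x' [Sx Ax]].
  destruct (HR y' x' Sy Sx) as [j [Hj E]].
  exists (fun i => y (i + j)). split; [now apply subshift_translate|].
  intros i Hi. rewrite <- Ax, <- E by auto. symmetry. apply Ay. lia.
Qed.

Lemma stages : exists P : nat -> cond, forall n, stage_step n (P n) (P (S n)).
Proof.
  assert (exists P0, stage_ok 0 P0) as HP0.
  (* The stages start from the full shift, with single letters as words. *)
  { unshelve refine (ex_intro _ {| len := 1; wa := fun _ => true; wb := fun _ => false;
      off := fun _ => 0 |} _).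
    - lia.
    - exists 0. split; [lia|discriminate].
    - intros _. lia.
    - split; [easy|]. simpl. lia. }
  pose (f := fix f n : {P | stage_ok n P} := match n with
    | O => constructive_indefinite_description _ HP0
    | S m => let P := f m in
      let Q := constructive_indefinite_description _ (stage m (proj1_sig P) (proj2_sig P)) in
      exist _ (proj1_sig Q) (proj1 (proj2_sig Q))
    end).
  exists (fun n => proj1_sig (f n)). intros n. simpl. apply proj2_sig.
Qed.

Theorem theorem3 :
  exists (X : point -> Prop) (x : (nat -> bool) -> point),
    minimal_subshift X /\
    (forall z, X (x z)) /\
    (forall z z' : nat -> bool, z <> z' ->
       point_incomparable (x z) (x z') /\
       ~ (exists y, X y /\ point_tle y (x z) /\ point_tle y (x z'))).
Proof.
  destruct stages as [P HP].
  assert (Dec : forall m n z x, (n <= m)%nat -> Cyl (P m) z x -> Cyl (P n) z x).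
  { intros m n z x Hnm. induction Hnm as [|m Hnm IH]; auto.
    intros H. apply IH. now apply (HP m). }
  pose (w := fun n z i => expand (P n) (fun _ => true) (i + off (P n) z)).
  assert (Hw : forall n z, Cyl (P n) z (w n z)).
  { intros n z. exists (fun _ => true). auto. }
  (* The value at [i] is final from stage [S (Z.abs_nat i)] on, the first condition known to be
     narrow at radius |i|. *)
  pose (x := fun z i => w (S (Z.abs_nat i)) z i).
  assert (Hx : forall n z, Cyl (P n) z (x z)).
  { intros n z. apply Cyl_closed. intros N. exists (w (max n (S N)) z).
    split; [apply (Dec (max n (S N))); auto; lia|].
    intros i Hi. destruct (HP (Z.abs_nat i)) as [_ [_ [Nar _]]].
    refine (Nar z _ (w _ z) _ (Hw _ _) i _); [|lia]. apply (Dec (max n (S N))); auto; lia. }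
  assert (HX : forall z, limit P (x z)).
  { intros z n N. exists (x z). split; [eapply Cyl_Sys, Hx|easy]. }
  assert (HD : forall z z', z <> z' ->
    ~ (exists y, limit P y /\ point_tle y (x z) /\ point_tle y (x z'))).
  { intros z z' Hz [y [Hy [[p Hp] [p' Hp']]]].
    assert (exists m, z' m <> z m) as [m Hm].
    { apply NNPP. intros A. apply Hz, functional_extensionality. intros m.
      apply NNPP. intros B. apply A. exists m. auto. }
    (* Large enough that [z] and [z'] differ below [n] and both program codes are below [n]. *)
    pose (n := S (m + program_code p + program_code p')).
    destruct (HP n) as [_ [_ [_ [_ A]]]].
    apply (A z z' (program_code p) (program_code p')) with (x := x z) (x' := x z') (y := y);
      auto; try (unfold n; lia).
    - intros S. apply Hm, S. unfold n. lia.
    - intros i. exists p. split; auto. apply Hp.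
    - intros i. exists p'. split; auto. apply Hp'. }
  exists (limit P), x. split; [|split; [auto|]].
  - split; [apply limit_subshift|]. split; [exists (x (fun _ => true)); auto|].
    apply limit_minimal. intros N. exists (S N). apply (HP N).
  - intros z z' Hz. split; [|auto]. split; intros H; apply (HD z z' Hz).
    + exists (x z). repeat split; auto. apply turing_le_refl.
    + exists (x z'). repeat split; auto. apply turing_le_refl.
Qed.
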